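(* Let $K$ be a field of characteristic $0$ and $C$ its algebraic closure. Let $G$ be a finite subgroup of $\mathrm{SL}(2,C)$ such that the values of the character of the natural $2$-dimensional representation given by the inclusion $G\subset\mathrm{SL}(2,C)$ are contained in $K$. Then: (i) If $G\cong\mathbb Z/n\mathbb Z$, then $G$ is realisable over $K$, i.e. $G$ is isomorphic to a subgroup of $\mathrm{SL}(2,K)$. (ii) If $G\cong BD_n$ (with $n\ge 2$), let $\xi\in C$ be a primitive $2n$-th root of unity and $c:=\frac12(\xi+\xi^{-1})$. Then $G$ is isomorphic to a subgroup of $\mathrm{SL}(2,K)$ if and only if $(\!(-1,c^2-1)\!)_K=1$. (iii) If $G\cong BT$, $BO$ or $BI$, then $G$ is isomorphic to a subgroup of $\mathrm{SL}(2,K)$ if and only if $(\!(-1,-1)\!)_K=1$.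
   Context: Groups: $BD_n=\langle\sigma,\tau\mid\tau^2=\sigma^n=(\tau\sigma)^2\rangle$ is the binary dihedral group of order $4n$, $n\ge2$; $BT=\langle a,b\mid a^3=b^3=(ab)^2\rangle$, $BO=\langle a,b\mid a^3=b^4=(ab)^2\rangle$, $BI=\langle a,b\mid a^3=b^5=(ab)^2\rangle$ are the binary tetrahedral, octahedral and icosahedral groups. Hilbert symbol: $(\!(\cdot,\cdot)\!)_K\colon K^*\times K^*\to\{-1,1\}$ is defined by $(\!(a,b)\!)_K=1$ if the equation $z^2-ax^2-by^2=0$ has a solution $(x,y,z)\in K^3\setminus\{(0,0,0)\}$, and $(\!(a,b)\!)_K=-1$ otherwise. *)

(* Defs.v *)
From HB Require Import structures.
From mathcomp Require Import all_boot all_order all_fingroup all_algebra.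
From mathcomp Require Import mxrepresentation.
From mathcomp Require Import finmap boolp.

Set Implicit Arguments.
Unset Strict Implicit.
Unset Printing Implicit Defensive.

Import GRing.Theory.
Local Open Scope ring_scope.

Record SL2_fingroup (F : fieldType) := SL2FinGroup {
  SL2_elts : {fset 'M[F]_2};
  SL2_det : forall A, A \in SL2_elts -> \det A = 1;
  SL2_mem1 : 1%:M \in SL2_elts;
  SL2_memM : forall A B, A \in SL2_elts -> B \in SL2_elts -> A *m B \in SL2_elts;
  SL2_memV : forall A, A \in SL2_elts -> invmx A \in SL2_elts
}.

Definition SL2_sort (F : fieldType) (G : SL2_fingroup F) : Type :=
  fset_sub_type (SL2_elts G).
Coercion SL2_sort : SL2_fingroup >-> Sortclass.

Section FinGroupStructure.
Variables (F : fieldType) (G : SL2_fingroup F).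

HB.instance Definition _ := Finite.copy (SL2_sort G) (fset_sub_type (SL2_elts G)).

Definition SL2_mx (g : G) : 'M[F]_2 := fsval g.

Definition SL2_one : G := FSetSub (SL2_mem1 G).
Definition SL2_mul (g h : G) : G := FSetSub (SL2_memM (fsvalP g) (fsvalP h)).
Definition SL2_inv (g : G) : G := FSetSub (SL2_memV (fsvalP g)).

Fact SL2_mulA : associative SL2_mul.
Proof. by move=> x y z; apply: val_inj; apply: mulmxA. Qed.

Fact SL2_mul1 : left_id SL2_one SL2_mul.
Proof. by move=> x; apply: val_inj; apply: mul1mx. Qed.

Fact SL2_mulV : left_inverse SL2_one SL2_inv SL2_mul.
Proof.
move=> x; apply: val_inj; apply: mulVmx.
by rewrite unitmxE (SL2_det (fsvalP x)) unitr1.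
Qed.

HB.instance Definition _ :=
  Finite_isGroup.Build (SL2_sort G) SL2_mulA SL2_mul1 SL2_mulV.

Fact SL2_mx_repr : mx_repr [set: G] SL2_mx.
Proof. by split. Qed.

Definition natural_repr : mx_representation F [set: G]%G 2 :=
  MxRepresentation SL2_mx_repr.

Definition natural_char (g : G) : F := \tr (natural_repr g).

End FinGroupStructure.

Definition realisable_over (F K : fieldType) (G : SL2_fingroup F) : Prop :=
  exists H : SL2_fingroup K, ([set: G] \isog [set: H])%g.

(* The presented groups below are finite, so [\isog Grp], which characterises
   the largest finite quotient of the presented group, is isomorphism with the
   presented group itself. *)
Definition is_BD (n : nat) (gT : finGroupType) (G : {group gT}) : Prop :=
  (G \isog Grp (s : t : t ^+ 2 = s ^+ n = (t * s) ^+ 2))%g.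

Definition is_BT (gT : finGroupType) (G : {group gT}) : Prop :=
  (G \isog Grp (a : b : a ^+ 3 = b ^+ 3 = (a * b) ^+ 2))%g.

Definition is_BO (gT : finGroupType) (G : {group gT}) : Prop :=
  (G \isog Grp (a : b : a ^+ 3 = b ^+ 4 = (a * b) ^+ 2))%g.

Definition is_BI (gT : finGroupType) (G : {group gT}) : Prop :=
  (G \isog Grp (a : b : a ^+ 3 = b ^+ 5 = (a * b) ^+ 2))%g.

(* Only meaningful for nonzero a and b. *)
Definition hilbert_symbol (K : fieldType) (a b : K) : int :=
  if `[< exists x y z : K, (x, y, z) <> (0, 0, 0)
          /\ z ^+ 2 - a * x ^+ 2 - b * y ^+ 2 = 0 >]
  then 1 else -1.

(* Main.v *)
(*
Over C, an element A of SL2 satisfies A^2 = tr(A) A - 1.  If t, u in M_2(C)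
satisfy t^2 = -1, u^2 = d, tu = -ut with d in K^*, and tr(g), tr(gt), tr(gu),
tr(gtu) lie in K for every g in G, then G lies in the quaternion algebra
(-1, d) over K spanned by 1, t, u, tu.  When d = z^2 + x^2 in K this algebra
splits, and conjugating t and u to explicit matrices over K conjugates G into
SL(2,K).  Conversely, if such t and u exist in M_2(K), then some nonzero
combination z + xt + yu has vanishing first row, so that its norm
z^2 + x^2 - d y^2 is zero.

A cyclic group is conjugate to one generated by a companion matrix.  For BD_n
take u = s - c, where s is the power of sigma with trace 2c; a model of order
4n inside SL(2,C) shows that sigma has order 2n.  For BT, BO, BI a noncommuting
model in S_5 shows that a and b do not commute; (ab)^2 commutes with a, which
forces tr(ab) = 0 and a^3 = b^k = (ab)^2 = -1.  This determines tr(a) = 1 and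
an equation for tau = tr(b), and explicit words in a and b are then
anticommuting square roots of -1.
*)
Require Import Defs.
From mathcomp Require Import all_boot all_order all_fingroup all_algebra.
From mathcomp Require Import cyclic.
From mathcomp Require Import finmap boolp ring.

Set Implicit Arguments.
Unset Strict Implicit.
Unset Printing Implicit Defensive.

Import GRing.Theory.
Local Open Scope ring_scope.

(** * Two by two matrices *)

Definition mx2 (R : Type) (a b c d : R) : 'M[R]_2 :=
  \matrix_(i, j) if i == 0 then (if j == 0 then a else b)
                 else (if j == 0 then c else d).

Lemma ord2P (k : 'I_2) : k = 0 \/ k = 1.
Proof. by case: k => [[|[|//]] lt_k]; [left | right]; apply: val_inj. Qed.

Lemma mx2P (R : Type) (A B : 'M[R]_2) :
  A 0 0 = B 0 0 -> A 0 1 = B 0 1 -> A 1 0 = B 1 0 -> A 1 1 = B 1 1 -> A = B.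
Proof.
move=> e00 e01 e10 e11; apply/matrixP => i j.
by case: (ord2P i) (ord2P j) => -> [] ->.
Qed.

Section Matrix2.
Variable F : fieldType.
Implicit Types A B : 'M[F]_2.

Lemma tr2 A : \tr A = A 0 0 + A 1 1.
Proof.
by rewrite /mxtrace !big_ord_recl big_ord0 addr0; congr (_ + A _ _); apply: val_inj.
Qed.

Lemma mulmx2E m (A : 'M[F]_(m, 2)) (B : 'M[F]_2) i j :
  (A *m B) i j = A i 0 * B 0 j + A i 1 * B 1 j.
Proof.
rewrite mxE !big_ord_recl big_ord0 addr0.
by have -> : lift ord0 ord0 = 1 :> 'I_2 by apply: val_inj.
Qed.

Lemma mul2 A B i j : (A * B) i j = A i 0 * B 0 j + A i 1 * B 1 j.
Proof. exact: mulmx2E. Qed.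

Lemma det2 A : \det A = A 0 0 * A 1 1 - A 0 1 * A 1 0.
Proof.
rewrite (expand_det_row A 0) !big_ord_recl big_ord0 addr0 /cofactor !det_mx11 !mxE.
have -> : lift ord0 ord0 = 1 :> 'I_2 by apply: val_inj.
have -> : lift 1 ord0 = 0 :> 'I_2 by apply: val_inj.
by rewrite /= expr0 expr1; ring.
Qed.

Lemma CayleyHamilton2 A : A * A = \tr A *: A - (\det A)%:M.
Proof. by apply: mx2P; rewrite mul2 tr2 det2 !mxE /=; ring. Qed.

Lemma sqr_SL2 A : \det A = 1 -> A * A = \tr A *: A - 1.
Proof. by move=> dA; rewrite CayleyHamilton2 dA. Qed.

End Matrix2.

(** * Quaternion algebras and rationality *)

Section Quaternions.
Variable F : fieldType.
Implicit Types (A t u : 'M[F]_2) (d : F).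

Lemma sqrN1_tr0 A : \det A = 1 -> \tr A = 0 -> A * A = - 1.
Proof. by move=> dA tA; rewrite sqr_SL2 // tA scale0r sub0r. Qed.

Lemma quaternion_isotropic t u d : t * t = - 1 -> u * u = d%:M ->
  t * u = - (u * t) ->
  exists x y z : F, (x, y, z) <> (0, 0, 0) /\
    z ^+ 2 - (-1) * x ^+ 2 - d * y ^+ 2 = 0.
Proof.
move=> tt uu tu.
have normE x y z : (z%:M + x *: t + y *: u) * (z%:M - x *: t - y *: u)
    = (z ^+ 2 - (-1) * x ^+ 2 - d * y ^+ 2)%:M.
  rewrite !(mulrDl, mulrBl, mulrDr, mulrN, mulNr) -!(scalerAl, scalerAr) tt uu tu.
  rewrite -[z%:M]scalemx1 -!(scalerAl, scalerAr) !mul1r !mulr1.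
  rewrite -[d%:M]scalemx1 -[RHS]scalemx1.
  by apply: mx2P; rewrite !mxE /=; ring.
have norm0 x y z : z + x * t 0 0 + y * u 0 0 = 0 -> x * t 0 1 + y * u 0 1 = 0 ->
    z ^+ 2 - (-1) * x ^+ 2 - d * y ^+ 2 = 0.
  move=> e0 e1; have := congr1 (fun A : 'M_2 => A 0 0) (normE x y z).
  by rewrite mul2 !mxE /= !(mulr1n, mulr0n) add0r e0 e1 !mul0r addr0 => <-.
(* [z + x t + y u] is chosen with vanishing first row, hence with norm [0]. *)
have [/andP[/eqP u0 /eqP t0]|nz] := boolP ((u 0 1 == 0) && (t 0 1 == 0)).
  exists 1, 0, (- t 0 0); split; last by apply: norm0; rewrite ?t0 ?u0; ring.
  by case=> /eqP; rewrite oner_eq0.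
exists (u 0 1), (- t 0 1), (t 0 1 * u 0 0 - t 0 0 * u 0 1).
split; last by apply: norm0; ring.
by case=> /eqP u0 /eqP; rewrite oppr_eq0 => t0 _; rewrite u0 t0 in nz.
Qed.

Lemma hilbert1P (a b : F) : hilbert_symbol a b = 1 <->
  exists x y z : F, (x, y, z) <> (0, 0, 0) /\
    z ^+ 2 - a * x ^+ 2 - b * y ^+ 2 = 0.
Proof. by rewrite /hilbert_symbol; case: asboolP => //; split. Qed.

Lemma sum_two_squares d : (2 : F) != 0 -> hilbert_symbol (-1) d = 1 ->
  exists z x : F, d = z ^+ 2 + x ^+ 2.
Proof.
move=> n2 /hilbert1P[x [y [z [nz]]]] e.
have [y0|y0] := eqVneq y 0; last first.
  exists (z / y), (x / y); apply: (mulIf (expf_neq0 2 y0)).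
  rewrite mulrDl !expr_div_n !divfK ?expf_neq0 //.
  by apply/eqP; rewrite eq_sym -subr_eq0 -e; apply/eqP; ring.
have e1 : z ^+ 2 = - x ^+ 2.
  by apply/eqP; rewrite -addr_eq0 -e y0; apply/eqP; ring.
have x0 : x != 0.
  apply/negP => /eqP x0; move: e1; rewrite x0 expr0n oppr0 => /eqP.
  by rewrite sqrf_eq0 => /eqP z0; apply: nz; rewrite x0 y0 z0.
(* Here -1 = (z/x)^2, so d = ((d+1)/2)^2 - ((d-1)/2)^2 becomes a sum of two squares. *)
exists ((d + 1) / 2), ((z / x) * (d - 1) / 2).
rewrite !exprMn e1 !exprVn mulNr mulfV ?expf_neq0 //.
by field; rewrite (natrM _ 2 2) mulf_neq0.
Qed.

End Quaternions.

(** * Conjugating a group over C into SL(2,K) *)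

Section Realisation.
Variables (K C : fieldType) (iota : {rmorphism K -> C}).

(** [P] has entries in C only. Each [M] is P g P^-1, and is unique because [iota] is injective on
    matrices; the chosen [f] is therefore an injective morphism, and [H] is its image. *)
Lemma realisable_conj (G : SL2_fingroup C) (P : 'M[C]_2) :
  P \in unitmx ->
  (forall g : G, exists M : 'M[K]_2, P *m SL2_mx g = map_mx iota M *m P) ->
  realisable_over K G.
Proof.
move=> uP /choice[f Pf].
have fE (g : G) M : P *m SL2_mx g = map_mx iota M *m P -> f g = M.
  rewrite Pf => /(can_inj (mulmxK uP)); exact: map_mx_inj.
have fI (g h : G) : f g = f h -> g = h.
  move=> e; apply: val_inj; apply: (can_inj (mulKmx uP)).
  by rewrite -[val g]/(SL2_mx g) -[val h]/(SL2_mx h) !Pf e.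
have fM (g h : G) : f (g * h)%g = f g *m f h.
  apply: fE; rewrite map_mxM -mulmxA -Pf mulmxA -Pf -mulmxA; congr (_ *m _).
have f1 : f 1%g = 1%:M.
  by apply: fE; rewrite map_mx1 mulmx1 mul1mx.
have fdet (g : G) : \det (f g) = 1.
  apply: (fmorph_inj iota); rewrite rmorph1 -det_map_mx.
  have dP : \det P != 0 by rewrite -unitfE.
  apply: (mulIf dP); rewrite -det_mulmx -Pf det_mulmx mul1r.
  by rewrite (SL2_det (fsvalP g)) mulr1.
have fV (g : G) : invmx (f g) = f g^-1%g.
  have ug : f g \in unitmx by rewrite unitmxE fdet unitr1.
  by apply: (can_inj (mulKmx ug)); rewrite mulmxV // -fM mulgV f1.
pose E : {fset 'M[K]_2} := [fset f g | g in [set: G]]%fset.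
have EP A : reflect (exists g, A = f g) (A \in E).
  apply: (iffP (imfsetP _ _ _ _)) => [[g _ ->]|[g ->]]; first by exists g.
  by exists g; rewrite ?inE.
have Edet A : A \in E -> \det A = 1 by case/EP=> g ->.
have E1 : 1%:M \in E by apply/EP; exists 1%g.
have EM A B : A \in E -> B \in E -> A *m B \in E.
  by case/EP=> g -> /EP[h ->]; apply/EP; exists (g * h)%g.
have EV A : A \in E -> invmx A \in E.
  by case/EP=> g ->; apply/EP; exists g^-1%g.
pose H := SL2FinGroup Edet E1 EM EV; exists H.
have Ef (g : G) : f g \in E by apply/EP; exists g.
pose phi (g : G) : H := FSetSub (Ef g).
have phiM : {in [set: G] &, {morph phi : g h / (g * h)%g}}.
  by move=> g h _ _; apply: val_inj; apply: fM.
apply/isogP; exists (Morphism phiM).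
  by apply/injmP => g h _ _ /(congr1 val); apply: fI.
apply/setP => h; rewrite inE; apply/morphimP.
have /EP[g hg] := fsvalP h.
by exists g; rewrite ?inE //; apply: val_inj.
Qed.

(** Writing d as a sum of two squares provides a matrix [U] over K with square d that anticommutes
    with [T]. Once t and u are conjugated to [T] and [U], the four traces form a linear system over
    K for the entries of P g P^-1. *)
Lemma realisable_quaternion (G : SL2_fingroup C) (t u : 'M[C]_2) (z x : K) :
  (2 : K) != 0 -> z ^+ 2 + x ^+ 2 != 0 ->
  t * t = - 1 -> u * u = (iota (z ^+ 2 + x ^+ 2))%:M -> t * u = - (u * t) ->
  (forall g : G, [/\ exists k, iota k = \tr (SL2_mx g),
     exists k, iota k = \tr (SL2_mx g * t),
     exists k, iota k = \tr (SL2_mx g * u) &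
     exists k, iota k = \tr (SL2_mx g * (t * u))]) ->
  realisable_over K G.
Proof.
move=> n2 d0 tt uu tu trG.
pose d := iota (z ^+ 2 + x ^+ 2).
have dC0 : d != 0 by rewrite fmorph_eq0.
have n2C : (2 : C) != 0 by rewrite -(rmorph_nat iota) fmorph_eq0.
have neq0 (a : C) : a = - a -> a = 0.
  move/eqP; rewrite -addr_eq0 -mulr2n -mulr_natl mulf_eq0 (negPf n2C) /=.
  exact: eqP.
pose N := u - (iota x *: t + (iota z)%:M).
(* [P] has rows [v] and [v t] with [v] in the left kernel of [N]: it conjugates
   [t] and [u] to the matrices [T] and [U] over [K]. *)
have [v v0 vN] : exists2 v : 'rV[C]_2, v != 0 & v *m N = 0.
  apply/det0P; apply/negPn/negP; rewrite -unitfE -unitmxE => uN.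
  (* Since (u - xt)^2 = d - x^2 = z^2, the product [N *m N'] vanishes. If [N] were invertible, u =
     xt - z would commute with t; anticommutation then gives ut = 0, against u^2 t^2 = -d. *)
  pose N' := u - iota x *: t + (iota z)%:M.
  have : N *m N' = 0.
    rewrite mulmxE /N /N' opprD addrA !(mulrDl, mulrBl, mulrDr, mulrN, mulNr).
    rewrite -!(scalerAl, scalerAr) tt uu tu.
    rewrite -[(iota z)%:M]scalemx1 -!(scalerAl, scalerAr) !mul1r !mulr1.
    rewrite -scalemx1 !rmorphD !rmorphXn.
    by apply: mx2P; rewrite !mxE /=; ring.
  move/(congr1 (mulmx (invmx N))); rewrite mulKmx // mulmx0 => /eqP.
  rewrite addr_eq0 subr_eq => /eqP ue.
  have cut : t * u = u * t.
    by rewrite ue mulrDr mulrDl -scalerAr -scalerAl mulrN mulNr -!mulmxE scalar_mxC.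
  have ut0 : u * t = 0.
    apply: mx2P; rewrite [RHS]mxE; apply: neq0;
    by rewrite -{1}cut tu mxE.
  have := congr1 (fun A => u * A * t) ut0.
  rewrite mulr0 mul0r mulrA uu -mulrA tt mulrN mulr1 => /eqP.
  rewrite oppr_eq0 => /eqP /matrixP /(_ 0 0); rewrite !mxE mulr1n => /eqP.
  by rewrite (negPf dC0).
have {vN} vu : v *m u = iota x *: (v *m t) + iota z *: v.
  by apply/eqP; rewrite -subr_eq0 scalemxAr -[iota z *: v]mul_mx_scalar -mulmxDr -mulmxBr vN.
have vtt : v *m t *m t = - v by rewrite -mulmxA -[t *m t]/(t * t) tt mulmxN mulmx1.
have vtu : v *m t *m u = iota x *: v - iota z *: (v *m t).
  rewrite -mulmxA -[t *m u]/(t * u) tu mulmxN mulmxA vu mulmxDl -!scalemxAl vtt.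
  by rewrite scalerN opprD opprK.
have [w wE] : exists w, w = v *m t by exists (v *m t).
rewrite -wE in vu vtt vtu.
pose P := mx2 (v 0 0) (v 0 1) (w 0 0) (w 0 1).
pose T := mx2 0 1 (-1) 0 : 'M[K]_2.
pose U := mx2 z x x (- z) : 'M[K]_2.
have PM (A : 'M[C]_2) (B : 'M[K]_2) :
   v *m A = iota (B 0 0) *: v + iota (B 0 1) *: w ->
   w *m A = iota (B 1 0) *: v + iota (B 1 1) *: w ->
   P *m A = map_mx iota B *m P.
  move=> /rowP ev /rowP ew.
  by apply: mx2P; rewrite !mul2 !mxE /= -mulmx2E ?ev ?ew !mxE.
have PT : P *m t = map_mx iota T *m P.
  apply: PM; first by rewrite !mxE /= rmorph0 rmorph1 scale0r add0r scale1r.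
  by rewrite vtt !mxE /= rmorphN rmorph0 rmorph1 scale0r addr0 scaleN1r.
have PU : P *m u = map_mx iota U *m P.
  apply: PM; first by rewrite vu !mxE addrC.
  by rewrite vtu !mxE /= rmorphN scaleNr.
have uP : P \in unitmx.
  rewrite unitmxE unitfE; apply/negP => /det0P[r r0 rP].
  have {rP}rvw : r 0 0 *: v + r 0 1 *: w = 0.
    have /rowP e := rP; apply/rowP => j; have := e j; rewrite mulmx2E !mxE.
    by have [->|->] := ord2P j.
  have r1 : r 0 1 != 0.
    apply/negP => /eqP r1; move/eqP: rvw; rewrite r1 scale0r addr0 scaler_eq0.
    rewrite (negPf v0) orbF => /eqP r00; case/negP: r0; apply/eqP/rowP => j.
    by have [->|->] := ord2P j; rewrite mxE.
  pose l := - (r 0 0 / r 0 1).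
  have wl : w = l *: v.
    apply: (scalerI r1); rewrite scalerA /l mulrN mulrCA mulfV // mulr1 scaleNr.
    by apply/eqP; rewrite -addr_eq0 addrC rvw.
  have scv (a b : C) : a *: v = b *: v -> a = b.
    by move/eqP; rewrite -subr_eq0 -scalerBl scaler_eq0 (negPf v0) orbF subr_eq0 => /eqP.
  have ll : l * l = - 1.
    by apply: scv; rewrite -scalerA -wl scaleN1r -vtt {2}wl -scalemxAl -wE.
  have lx : iota x - iota z * l = 0.
    apply: neq0; apply: scv.
    rewrite scalerBl -[in LHS]scalerA -wl -vtu wl -scalemxAl vu wl.
    rewrite [iota x *: _]scalerA.
    rewrite -scalerDl scalerA; congr (_ *: _).
    by rewrite mulrDr mulrCA ll; ring.
  case/eqP: dC0; rewrite /d rmorphD !rmorphXn /=.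
  by move/eqP: lx; rewrite subr_eq0 => /eqP ->; ring: ll.
(* The traces of [M], [M T], [M U], [M T U] determine the entries of [M]. *)
apply: (realisable_conj uP) => g.
have [[k1 e1] [k2 e2] [k3 e3] [k4 e4]] := trG g.
have [M gM] : exists M, P *m SL2_mx g = M *m P.
  by exists (P *m SL2_mx g *m invmx P); rewrite mulmxKV.
have trP X Y : P *m X = Y *m P -> \tr X = \tr Y.
  by move=> e; rewrite -[X](mulKmx uP) e mxtrace_mulC mulmxK.
have trM (A : 'M[C]_2) B : P *m A = map_mx iota B *m P ->
    \tr (SL2_mx g * A) = \tr (M * map_mx iota B).
  by move=> e; apply: trP; rewrite mulmxA gM -mulmxA e mulmxA.
have {}e1 : iota k1 = M 0 0 + M 1 1 by rewrite e1 (trP _ _ gM) tr2.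
have {}e2 : iota k2 = M 1 0 - M 0 1.
  rewrite e2 (trM _ _ PT) tr2 !mul2 !mxE /= rmorphN rmorph1 rmorph0; ring.
have {}e3 : iota k3 = iota z * (M 0 0 - M 1 1) + iota x * (M 0 1 + M 1 0).
  rewrite e3 (trM _ _ PU) tr2 !mul2 !mxE /= rmorphN; ring.
have {}e4 : iota k4 = iota x * (M 0 0 - M 1 1) - iota z * (M 0 1 + M 1 0).
  have PTU : P *m (t * u) = map_mx iota (T * U) *m P.
    by rewrite mulmxA PT -mulmxA PU mulmxA map_mxM.
  rewrite e4 (trM _ _ PTU) tr2 !mul2 !mxE !big_ord_recl !big_ord0 !mxE /=.
  rewrite !(rmorphD, rmorphM, rmorphN, rmorph0, rmorph1); ring.
pose D := z ^+ 2 + x ^+ 2.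
(* [z * k3 + x * k4] is D times the difference of the diagonal entries of [M], and [x * k3 - z * k4]
   is D times the sum of the off-diagonal ones. *)
exists (mx2 ((k1 + (z * k3 + x * k4) / D) / 2) (((x * k3 - z * k4) / D - k2) / 2)
            (((x * k3 - z * k4) / D + k2) / 2) ((k1 - (z * k3 + x * k4) / D) / 2)).
rewrite gM; congr (_ *m _); move: dC0.
rewrite /d rmorphD !rmorphXn /= => dC0.
apply: mx2P; rewrite !mxE /= /D.
all: rewrite !(rmorphD, rmorphB, rmorphM, rmorphN, fmorphV, rmorph_nat, rmorphXn).
all: rewrite /= ?e1 ?e2 ?e3 ?e4.
all: by field; rewrite dC0 n2C.
Qed.
End Realisation.

(** * Finite subgroups of SL2 and the cyclic case *)

Section SL2Group.
Variables (F : fieldType) (G : SL2_fingroup F).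
Implicit Types g h : G.

Lemma SL2_mx_inj : injective (@SL2_mx F G).
Proof. by move=> g h e; apply: val_inj. Qed.

Lemma SL2_mxM g h : SL2_mx (g * h)%g = SL2_mx g * SL2_mx h.
Proof. by []. Qed.

Lemma SL2_mx1 : SL2_mx (1%g : G) = 1.
Proof. by []. Qed.

Lemma SL2_mxX g n : SL2_mx (g ^+ n)%g = SL2_mx g ^+ n.
Proof. by elim: n => // n IHn; rewrite expgS exprS SL2_mxM IHn. Qed.

Lemma det_SL2_mx g : \det (SL2_mx g) = 1.
Proof. exact: SL2_det (fsvalP g). Qed.

Lemma SL2_mxV g : SL2_mx g^-1%g = \tr (SL2_mx g) *: 1 - SL2_mx g.
Proof.
have uA : SL2_mx g \in unitmx by rewrite unitmxE det_SL2_mx unitr1.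
apply: (can_inj (mulKmx uA)); rewrite mulmxE -SL2_mxM mulgV SL2_mx1.
by rewrite mulrBr -scalerAr mulr1 sqr_SL2 ?det_SL2_mx // opprB addrCA subrr addr0.
Qed.

(** By Cayley-Hamilton, A^2 = 1 gives tr(A) A = 2, so A is a scalar with square 1. *)
Lemma SL2_involution g : (2 : F) != 0 -> (g ^+ 2 = 1)%g -> g <> 1%g -> SL2_mx g = - 1.
Proof.
move=> n2 gg g1; have dA := det_SL2_mx g.
have AA : SL2_mx g * SL2_mx g = 1 by rewrite -SL2_mxM -[(g * g)%g]/(g ^+ 2)%g gg.
have : \tr (SL2_mx g) *: SL2_mx g = 2 *: 1.
  by rewrite scaler_nat mulr2n -{2}AA sqr_SL2 // addrCA subrr addr0.
set A := SL2_mx g in dA AA *; set c := \tr A => cA.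
have c0 : c != 0.
  apply/eqP => c0; move: cA; rewrite c0 scale0r => /esym/eqP.
  by rewrite scaler_eq0 (negPf n2) oner_eq0.
have eA : A = (2 / c) *: 1.
  by apply: (scalerI c0); rewrite cA scalerA mulrCA divff // mulr1.
have : (2 / c) ^+ 2 = 1.
  move: AA; rewrite eA -scalerAl mul1r scalerA => /matrixP/(_ 0 0).
  by rewrite !mxE mulr1n mulr1.
move/eqP; rewrite sqrf_eq1 => /orP[]/eqP e; last by rewrite eA e scaleN1r.
by case: g1; apply: SL2_mx_inj; rewrite -/A eA e scale1r.
Qed.

End SL2Group.

Section Cyclic.
Variables (K C : fieldType) (iota : {rmorphism K -> C}).

Lemma companion2 (A : 'M[C]_2) : \det A = 1 ->
  (exists2 P, P \in unitmx & P *m A = mx2 0 1 (-1) (\tr A) *m P) \/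
  exists2 a, a ^+ 2 = 1 & A = a%:M.
Proof.
move=> dA.
(* [w x y] is the determinant of the rows v = (x, y) and vA. If it is nonzero, these rows form a
   basis in which A is a companion matrix; if it vanishes at (1,0), (0,1) and (1,1), A is scalar. *)
pose w x y := x * (x * A 0 1 + y * A 1 1) - y * (x * A 0 0 + y * A 1 0).
have wP x y : w x y != 0 ->
  exists2 P, P \in unitmx & P *m A = mx2 0 1 (-1) (\tr A) *m P.
  move=> wxy; exists (mx2 x y (x * A 0 0 + y * A 1 0) (x * A 0 1 + y * A 1 1)).
    by rewrite unitmxE unitfE det2 !mxE.
  have d1 : A 0 0 * A 1 1 = 1 + A 0 1 * A 1 0.
    by apply/eqP; rewrite -subr_eq -det2 dA.
  by apply: mx2P; rewrite !mul2 tr2 !mxE /=; ring: d1.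
have [w10|] := eqVneq (w 1 0) 0; last by move/wP; left.
have [w01|] := eqVneq (w 0 1) 0; last by move/wP; left.
have [w11|] := eqVneq (w 1 1) 0; last by move/wP; left.
have A01 : A 0 1 = 0 by move: w10; rewrite /w !mul0r !mul1r subr0 addr0.
have A10 : A 1 0 = 0.
  by move: w01; rewrite /w !mul0r !mul1r sub0r add0r => /eqP; rewrite oppr_eq0 => /eqP.
have A11 : A 1 1 = A 0 0.
  by apply/eqP; move: w11; rewrite /w !mul1r A01 A10 add0r addr0 => /eqP; rewrite subr_eq0.
right; exists (A 0 0); first by rewrite -dA det2 A01 A10 A11; ring.
by apply: mx2P; rewrite !mxE.
Qed.

Lemma realisable_cyclic (G : SL2_fingroup C) :
  cyclic [set: G] -> (forall g : G, exists k : K, iota k = natural_char g) ->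
  realisable_over K G.
Proof.
move=> /cyclicP[g genG] trG.
have power (P : 'M[C]_2) (M : 'M[K]_2) : P \in unitmx ->
    P *m SL2_mx g = map_mx iota M *m P -> realisable_over K G.
  move=> uP PM; apply: (realisable_conj uP) => h.
  have /cycleP[i ->] : h \in <[g]>%g by rewrite -genG inE.
  exists (M ^+ i); rewrite SL2_mxX; elim: i => [|i IHi].
    by rewrite !expr0 map_mx1 mulmx1 mul1mx.
  by rewrite !exprSr mulmxA IHi -mulmxA PM mulmxA map_mxM.
have [[P uP PA]|[a a2 gE]] := companion2 (det_SL2_mx g).
  have [k ke] := trG g; apply: (power P (mx2 0 1 (-1) k)) => //.
  rewrite PA; congr (_ *m _).
  by apply: mx2P; rewrite !mxE /= ?rmorphN ?rmorph0 ?rmorph1 ?ke.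
have [k ke] : exists k, iota k = a.
  move/eqP: a2; rewrite sqrf_eq1 => /orP[]/eqP ->; first by exists 1; rewrite rmorph1.
  by exists (- 1); rewrite rmorphN rmorph1.
apply: (power 1%:M k%:M); first exact: unitmx1.
by rewrite mul1mx mulmx1 map_scalar_mx gE; congr _%:M.
Qed.

End Cyclic.

Lemma cyclic_Zp n : cyclic (Zp n).
Proof.
rewrite /Zp; case: ifP => _; last exact: cyclic1.
by apply/cyclicP; exists Zp1; rewrite -Zp_cycle.
Qed.

(** * Polyhedral groups *)

Section QuaternionCoordinates.
Variables (F : fieldType) (x a : 'M[F]_2) (tau : F).
Hypotheses (xx : x * x = - 1) (aa : a * a = a - 1)
  (ax : a * x = x - tau *: 1 - x * a).

(** The span of 1, x, a, xa is closed under products, so identities between words become polynomial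
    identities in [tau], which stands for tr(b). *)
Definition qcomb (k0 k1 k2 k3 : F) : 'M[F]_2 :=
  k0 *: 1 + k1 *: x + k2 *: a + k3 *: (x * a).

Lemma qcombM k0 k1 k2 k3 l0 l1 l2 l3 :
  qcomb k0 k1 k2 k3 * qcomb l0 l1 l2 l3 = qcomb
    (k0 * l0 - k1 * l1 - tau * k2 * l1 - k2 * l2 - k3 * l1 - k3 * l3)
    (k0 * l1 + k1 * l0 + k2 * l1 + k2 * l3 - tau * k3 * l1 - k3 * l2)
    (k0 * l2 + k2 * l0 - k1 * l3 + k2 * l2 - tau * k2 * l3 + k3 * l1)
    (k0 * l3 + k3 * l0 + k1 * l2 - k2 * l1 + k3 * l2 - tau * k3 * l3).
Proof.
have xxa : x * (x * a) = - a by rewrite mulrA xx mulN1r.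
have axa : a * (x * a) = x - tau *: a.
  rewrite mulrA ax !mulrBl -scalerAl mul1r -mulrA aa mulrBr mulr1.
  by move: (x * a) => y; apply/matrixP=> i j; rewrite !mxE; ring.
have xax : (x * a) * x = - 1 - tau *: x + a.
  by rewrite -mulrA ax !mulrBr -scalerAr mulr1 xx xxa opprK.
have xa_a : (x * a) * a = x * a - x by rewrite -mulrA aa mulrBr mulr1.
have xaxa : (x * a) * (x * a) = - 1 - tau *: (x * a).
  rewrite mulrA xax !(mulrDl, mulNr) -scalerAl aa mul1r.
  by move: (x * a) => y; apply/matrixP=> i j; rewrite !mxE; ring.
rewrite /qcomb !(mulrDl, mulrDr) -!(scalerAl, scalerAr) !mul1r !mulr1.
rewrite xaxa xa_a xax axa xxa aa ax xx; move: (x * a) => y.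
by apply/matrixP=> i j; rewrite !mxE; ring.
Qed.

Lemma qcomb_x : x = qcomb 0 1 0 0.
Proof. by rewrite /qcomb !scale0r scale1r !addr0 add0r. Qed.

Lemma qcomb_a : a = qcomb 0 0 1 0.
Proof. by rewrite /qcomb !scale0r scale1r !addr0 add0r. Qed.

Lemma qcomb_1Ba : 1 - a = qcomb 1 0 (-1) 0.
Proof. by rewrite /qcomb !scale0r scaleN1r scale1r !addr0. Qed.

Lemma qcomb_N1 : - 1 = qcomb (- 1) 0 0 0.
Proof. by rewrite /qcomb !scale0r scaleN1r !addr0. Qed.

Lemma qcombN k0 k1 k2 k3 : - qcomb k0 k1 k2 k3 = qcomb (- k0) (- k1) (- k2) (- k3).
Proof. by rewrite /qcomb !scaleNr !opprD. Qed.

Definition quaternion_pair (i j : 'M[F]_2) : Prop :=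
  [/\ i * i = - 1, j * j = - 1 & i * j = - (j * i)].

(** As a^2 = a - 1, the factor 1 - a is the inverse of a: the second element is the conjugate of x
    by a, as i is sent to j inside the quaternion group of order 8. *)
Lemma tetrahedral_pair : tau = 1 -> quaternion_pair x (a * x * (1 - a)).
Proof.
move=> t1.
have -> : a * x * (1 - a) = qcomb (-1) 0 1 (-1).
  by rewrite qcomb_1Ba qcomb_a qcomb_x !qcombM t1; congr qcomb; ring.
split; [by [] | | rewrite qcomb_x]; rewrite ?qcomb_N1 !qcombM ?qcombN t1; congr qcomb; ring.
Qed.

(** Here [b] has trace [tau] and order 8 in BO, so b^2, rather than x, lies in the normal quaternion
    subgroup; its conjugate by a is the partner. *)
Lemma octahedral_pair : tau ^+ 2 = 2 ->
  let b := tau *: 1 + x * a in quaternion_pair (b * b) (a * (b * b) * (1 - a)).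
Proof.
move=> t2 b.
have bE : b = qcomb tau 0 0 1.
  by rewrite /b /qcomb !scale0r scale1r !addr0.
have bb : b * b = qcomb 1 0 0 tau by rewrite bE qcombM; congr qcomb; ring: t2.
have -> : a * (b * b) * (1 - a) = qcomb (-1) tau 0 (- tau).
  by rewrite bb qcomb_1Ba qcomb_a !qcombM; congr qcomb; ring: t2.
rewrite bb /quaternion_pair qcomb_N1 !qcombM !qcombN; split; congr qcomb; ring: t2.
Qed.

(** With a^-1 = 1 - a, the second element is the word a x a^-1 x a x a^-1 x a. Modulo -1 it is an
    involution commuting with x. *)
Lemma icosahedral_pair : tau ^+ 2 = tau + 1 ->
  quaternion_pair x ((a * x * ((1 - a) * x)) * a * ((x * (1 - a)) * (x * a))).
Proof.
move=> t2.
have -> : a * x * ((1 - a) * x) * a * (x * (1 - a) * (x * a)) =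
    qcomb (- tau) (- 1 - tau) (2 * tau) 0.
  have e1 : a * x = qcomb (- tau) 1 0 (-1).
    by rewrite qcomb_a qcomb_x qcombM; congr qcomb; ring: t2.
  have e2 : (1 - a) * x = qcomb tau 0 0 1.
    by rewrite qcomb_1Ba qcomb_x qcombM; congr qcomb; ring: t2.
  have e3 : x * (1 - a) = qcomb 0 1 0 (-1).
    by rewrite qcomb_1Ba qcomb_x qcombM; congr qcomb; ring: t2.
  have e4 : x * a = qcomb 0 0 0 1 by rewrite /qcomb !scale0r scale1r !add0r.
  have e5 : a * x * ((1 - a) * x) = qcomb (- tau) tau (-1) (- tau).
    by rewrite e1 e2 qcombM; congr qcomb; ring: t2.
  have e6 : x * (1 - a) * (x * a) = qcomb 1 0 (-1) tau.
    by rewrite e3 e4 qcombM; congr qcomb; ring: t2.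
  rewrite e6 e5.
  have -> : qcomb (- tau) tau (-1) (- tau) * a = qcomb 1 tau (- 1 - tau) 0.
    by rewrite qcomb_a qcombM; congr qcomb; ring: t2.
  by rewrite qcombM; congr qcomb; ring: t2.
split; [by [] | | rewrite qcomb_x]; rewrite ?qcomb_N1 !qcombM ?qcombN; congr qcomb; ring: t2.
Qed.

End QuaternionCoordinates.

(** * Noncommuting generators from quotients in S_5 *)

Lemma triangle_modelP (gT : finGroupType) (a c : gT) k : (a ^+ 3 = 1)%g ->
  (c ^+ 2 = 1)%g -> ((a^-1 * c) ^+ k = 1)%g -> (a * c <> c * a)%g ->
  exists a b : gT, [/\ (a ^+ 3 = 1)%g, (b ^+ k = 1)%g, ((a * b) ^+ 2 = 1)%g
    & (a * b <> b * a)%g].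
Proof.
move=> a3 c2 bk ac; exists a, (a^-1 * c)%g; split; rewrite ?mulKVg // => e.
by apply: ac; rewrite {1}e -!mulgA mulKVg.
Qed.

(** The models are the rotation groups A_4, S_4 and A_5: [a] is a 3-cycle, [c] = ab an involution,
    and b = a^-1 c a cycle of length k. *)
Lemma triangle_model k : k \in [:: 3; 4; 5]%N ->
  exists a b : 'S_5, [/\ (a ^+ 3 = 1)%g, (b ^+ k = 1)%g, ((a * b) ^+ 2 = 1)%g
    & (a * b <> b * a)%g].
Proof.
pose o0 : 'I_5 := @Ordinal 5 0 isT.
pose o1 : 'I_5 := @Ordinal 5 1 isT.
pose o2 : 'I_5 := @Ordinal 5 2 isT.
pose o3 : 'I_5 := @Ordinal 5 3 isT.
pose o4 : 'I_5 := @Ordinal 5 4 isT.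
pose a : 'S_5 := (tperm o0 o1 * tperm o0 o2)%g.
have eqp (s t : 'S_5) :
    [&& s o0 == t o0, s o1 == t o1,
        s o2 == t o2, s o3 == t o3 &
        s o4 == t o4] -> s = t.
  case/and5P=> /eqP e0 /eqP e1 /eqP e2 /eqP e3 /eqP e4; apply/permP.
  by case=> [[|[|[|[|[|//]]]]] lt_i]; rewrite (bool_irrelevance lt_i isT).
have aE : ((a o0 = o1) * (a o1 = o2) * (a o2 = o0) * (a o3 = o3) * (a o4 = o4))%type.
  by rewrite /a; do !split; apply: val_inj; rewrite permM !permE.
have aVE : ((a^-1%g o0 = o2) * (a^-1%g o1 = o0) * (a^-1%g o2 = o1) *
    (a^-1%g o3 = o3) * (a^-1%g o4 = o4))%type.
  by do !split; apply: (canLR (permK a)); rewrite aE.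
have a3 : (a ^+ 3 = 1)%g by apply: eqp; rewrite !permX /= !aE !perm1 !eqxx.
have P c : (c ^+ 2 = 1)%g -> ((a^-1 * c) ^+ k = 1)%g -> (c (a o0) != a (c o0)) ->
    exists a b : 'S_5, [/\ (a ^+ 3 = 1)%g, (b ^+ k = 1)%g, ((a * b) ^+ 2 = 1)%g
      & (a * b <> b * a)%g].
  move=> c2 bk /eqP c0; apply: (triangle_modelP a3 c2 bk) => e.
  by apply: c0; rewrite -!permM e.
rewrite !inE => /or3P[]/eqP kE; rewrite kE in P *.
- pose c : 'S_5 := (tperm o0 o3 * tperm o1 o2)%g.
  have cE : ((c o0 = o3) * (c o1 = o2) * (c o2 = o1) * (c o3 = o0) * (c o4 = o4))%type.
    by rewrite /c; do !split; apply: val_inj; rewrite ?permM !permE.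
  have bE : (((a^-1 * c)%g o0 = o1) * ((a^-1 * c)%g o1 = o3) *
      ((a^-1 * c)%g o2 = o2) * ((a^-1 * c)%g o3 = o0) * ((a^-1 * c)%g o4 = o4))%type.
    by rewrite !(permM a^-1%g) !aVE !cE.
  apply: (P c); [apply: eqp | apply: eqp | by rewrite !(aE, cE)];
    by rewrite !permX /= ?cE ?bE !perm1 !eqxx.
- pose c : 'S_5 := (tperm o0 o3)%g.
  have cE : ((c o0 = o3) * (c o1 = o1) * (c o2 = o2) * (c o3 = o0) * (c o4 = o4))%type.
    by rewrite /c; do !split; apply: val_inj; rewrite ?permM !permE.
  have bE : (((a^-1 * c)%g o0 = o2) * ((a^-1 * c)%g o1 = o3) *
      ((a^-1 * c)%g o2 = o1) * ((a^-1 * c)%g o3 = o0) * ((a^-1 * c)%g o4 = o4))%type.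
    by rewrite !(permM a^-1%g) !aVE !cE.
  apply: (P c); [apply: eqp | apply: eqp | by rewrite !(aE, cE)];
    by rewrite !permX /= ?cE ?bE !perm1 !eqxx.
- pose c : 'S_5 := (tperm o0 o3 * tperm o1 o4)%g.
  have cE : ((c o0 = o3) * (c o1 = o4) * (c o2 = o2) * (c o3 = o0) * (c o4 = o1))%type.
    by rewrite /c; do !split; apply: val_inj; rewrite ?permM !permE.
  have bE : (((a^-1 * c)%g o0 = o2) * ((a^-1 * c)%g o1 = o3) *
      ((a^-1 * c)%g o2 = o4) * ((a^-1 * c)%g o3 = o0) * ((a^-1 * c)%g o4 = o1))%type.
    by rewrite !(permM a^-1%g) !aVE !cE.
  apply: (P c); [apply: eqp | apply: eqp | by rewrite !(aE, cE)];
    by rewrite !permX /= ?cE ?bE !perm1 !eqxx.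
Qed.

Lemma triangle_generators k (gT : finGroupType) (G : {group gT}) :
  k \in [:: 3; 4; 5]%N ->
  (G \isog Grp (a : b : a ^+ 3 = b ^+ k = (a * b) ^+ 2))%g ->
  exists a b : gT, [/\ (a ^+ 3 = (a * b) ^+ 2)%g, (b ^+ k = (a * b) ^+ 2)%g
    & (a * b <> b * a)%g].
Proof.
move=> k345 isoG; have /existsP[[a b] /=] := isoGrp_hom isoG.
rewrite !xpair_eqE => /and3P[/eqP defG /eqP ea /eqP eb].
exists a, b; split=> // cab.
have abG : abelian G.
  rewrite -defG abelianY !cycle_abelian cent_cycle cycle_subG.
  by apply/cent1P.
(* In the model all three words equal 1, so it is a homomorphic image of G; an abelian G would make
   it abelian. *)
have [a' [b' [ea' eb' eab' ncab']]] := triangle_model k345.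
pose H := (<[a']> <*> <[b']>)%G.
have /homgP[f fG] : (H \homg G)%g.
  rewrite isoG; apply/existsP; exists (a', b').
  by rewrite /= !xpair_eqE ea' eb' eab' !eqxx.
have abH : abelian H by rewrite -fG morphim_abelian.
apply: ncab'; apply: (centsP abH).
  by rewrite (subsetP (joing_subl _ _)) ?cycle_id.
by rewrite (subsetP (joing_subr _ _)) ?cycle_id.
Qed.

(** * Traces forced by the relations *)

Section NonCommuting.
Variables (F : fieldType) (A B : 'M[F]_2).
Hypotheses (dA : \det A = 1) (dB : \det B = 1) (ncAB : A * B <> B * A).

(** Cayley-Hamilton reduces a relation A^k = -1 to a linear one between A and 1. A is not scalar, as
    it does not commute with B, so both coefficients vanish, giving equations for tr(A). *)
Lemma noncomm_scalar (c e : F) : c *: A = e *: 1 -> c = 0 /\ e = 0.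
Proof.
move=> cA; have c0 : c = 0.
  apply/eqP/negPn/negP => c0; apply: ncAB.
  have -> : A = (c^-1 * e) *: 1 by rewrite -scalerA -cA scalerA mulVf // scale1r.
  by rewrite -scalerAl -scalerAr mul1r mulr1.
split=> //; move/esym/eqP: cA; rewrite c0 scale0r scaler_eq0 oner_eq0 orbF.
by move/eqP.
Qed.

Lemma mulr_SL2_inj (X Y : 'M[F]_2) : A * X = A * Y -> X = Y.
Proof.
have uA : A \in unitmx by rewrite unitmxE dA unitr1.
exact: (can_inj (mulKmx uA)).
Qed.

(** (AB)^2 = tr(AB) AB - 1 commutes with A; if the trace were nonzero, AB and hence B would commute
    with A. *)
Lemma central_sqr_tr0 : A * (A * B * (A * B)) = A * B * (A * B) * A -> \tr (A * B) = 0.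
Proof.
have dAB : \det (A * B) = 1 by rewrite -mulmxE det_mulmx dA dB mulr1.
rewrite sqr_SL2 // mulrBr mulrBl mulr1 mul1r => /addIr.
rewrite -scalerAr -scalerAl => e; apply/eqP/negPn/negP => t0.
by apply: ncAB; apply: mulr_SL2_inj; rewrite (scalerI t0 e) mulrA.
Qed.

Lemma tr_cubeN1 : A ^+ 3 = - 1 -> \tr A = 1.
Proof.
rewrite exprS expr2 (sqr_SL2 dA) mulrBr mulr1 -scalerAr (sqr_SL2 dA).
set t := \tr A => e.
have {}e : (t ^+ 2 - 1) *: A = (t - 1) *: 1.
  apply/eqP; rewrite -subr_eq0 -[X in _ == X](subrr (- 1)) -{1}e.
  by apply/eqP/matrixP => i j; rewrite !mxE; ring.
by have [_ /eqP] := noncomm_scalar e; rewrite subr_eq0 => /eqP.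
Qed.

Lemma tr_pow4N1 : A ^+ 4 = - 1 -> \tr A ^+ 2 = 2.
Proof.
rewrite (exprM A 2 2) !expr2 (sqr_SL2 dA); set t := \tr A => e.
have {}e : (t ^+ 3 - 2 * t) *: A = (t ^+ 2 - 2) *: 1.
  apply/eqP; rewrite -subr_eq0 -[X in _ == X](subrr (- 1)) -{1}e.
  rewrite !(mulrBr, mulrBl) -!scalerAl -!scalerAr (sqr_SL2 dA) !mulr1 !mul1r -/t.
  by apply/eqP/matrixP => i j; rewrite !mxE; ring.
by have [_ /eqP] := noncomm_scalar e; rewrite subr_eq0 => /eqP.
Qed.

Lemma tr_pow5N1 : A ^+ 5 = - 1 -> \tr A ^+ 2 = \tr A + 1.
Proof.
rewrite exprS (exprM A 2 2) !expr2 (sqr_SL2 dA); set t := \tr A => e.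
have {}e : (t ^+ 4 - 3 * t ^+ 2 + 1) *: A = (t ^+ 3 - 2 * t - 1) *: 1.
  apply/eqP; rewrite -subr_eq0 -[X in _ == X](subrr (- 1)) -{1}e.
  rewrite !(mulrBr, mulrBl) -!scalerAl -!scalerAr (sqr_SL2 dA) !mulr1 !mul1r -/t.
  rewrite !(mulrBr, mulrBl) -!scalerAr (sqr_SL2 dA) !mulr1 -/t.
  by apply/eqP/matrixP => i j; rewrite !mxE; ring.
have [e4 e3] := noncomm_scalar e.
apply/eqP; rewrite -subr_eq0; apply/eqP.
(* The coefficients factor as (t+1)(t^2-t-1) and (t^2+t-1)(t^2-t-1); this combination isolates their
   common factor. *)
have : t ^+ 2 - (t + 1) = t * (t ^+ 3 - 2 * t - 1) - (t ^+ 4 - 3 * t ^+ 2 + 1).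
  ring.
by rewrite e4 e3 mulr0 subr0.
Qed.

End NonCommuting.

(** As b^-1 = tr(b) - b, the equation x b^-1 = a multiplied by x gives xa = b - tr(b), while ax =
    a^2 b = x - b. *)
Lemma triangle_coordinates (F : fieldType) (a b : 'M[F]_2) :
  \det a = 1 -> \det b = 1 -> \tr a = 1 -> a * b * (a * b) = - 1 ->
  b = \tr b *: 1 + a * b * a /\ a * (a * b) = a * b - \tr b *: 1 - a * b * a.
Proof.
move=> da db ta; set x := a * b => xx; set tau := \tr b.
have aa : a * a = a - 1 by rewrite (sqr_SL2 da) ta scale1r.
have bb : b * (tau *: 1 - b) = 1.
  by rewrite mulrBr -scalerAr mulr1 (sqr_SL2 db) opprB addrCA subrr addr0.
have xa : x * a = b - tau *: 1.
  have : x * (tau *: 1 - b) = a by rewrite -mulrA bb mulr1.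
  move=> <-; rewrite mulrA xx mulN1r opprB //.
split; first by rewrite xa addrC subrK.
by rewrite xa /x mulrA aa mulrBl mul1r opprB addrA subrK.
Qed.

(** The pair lies in the group itself. Over C the traces needed for realisation are then character
    values; over K the pair makes the norm form isotropic. *)
Lemma triangle_quaternions (F : fieldType) (G : SL2_fingroup F) k :
  k \in [:: 3; 4; 5]%N ->
  ([set: G] \isog Grp (a : b : a ^+ 3 = b ^+ k = (a * b) ^+ 2))%g ->
  exists i j : G, quaternion_pair (SL2_mx i) (SL2_mx j).
Proof.
move=> k345 isoG.
have [a [b [ea eb ncab]]] := triangle_generators (G := [set: G]%G) k345 isoG.
set A := SL2_mx a; set B := SL2_mx b.
have [dA dB] : \det A = 1 /\ \det B = 1 by rewrite !det_SL2_mx.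
have nAB : A * B <> B * A.
  by rewrite -!SL2_mxM => /SL2_mx_inj.
have nBA : B * A <> A * B by move/esym.
have eAB : A ^+ 3 = A * B * (A * B) by rewrite -!SL2_mxM -SL2_mxX ea.
have eBB : B ^+ k = A * B * (A * B) by rewrite -!SL2_mxM -SL2_mxX eb.
have trAB : \tr (A * B) = 0.
  by apply: (central_sqr_tr0 dA dB nAB); rewrite -eAB -exprS -exprSr.
have xx : A * B * (A * B) = - 1.
  by apply: sqrN1_tr0 => //; rewrite -SL2_mxM det_SL2_mx.
rewrite xx in eAB eBB.
have tA : \tr A = 1 := tr_cubeN1 dA nAB eAB.
have aa : A * A = A - 1 by rewrite sqr_SL2 // tA scale1r.
have VA : SL2_mx a^-1%g = 1 - A by rewrite SL2_mxV tA scale1r.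
have [eB ax] := triangle_coordinates dA dB tA xx.
move: k345 eBB {eb isoG}; rewrite !inE => /or3P[]/eqP-> eBB.
- have t1 : \tr B = 1 := tr_cubeN1 dB nBA eBB.
  exists (a * b)%g, (a * (a * b) * a^-1)%g.
  by rewrite !SL2_mxM VA; apply: tetrahedral_pair xx aa ax t1.
- have t2 := tr_pow4N1 dB nBA eBB.
  exists (b * b)%g, (a * (b * b) * a^-1)%g.
  rewrite !SL2_mxM VA -/B -/A eB.
  exact: (octahedral_pair xx aa ax t2).
have t2 := tr_pow5N1 dB nBA eBB.
exists (a * b)%g,
  (a * (a * b) * (a^-1 * (a * b)) * a * (a * b * a^-1 * (a * b * a)))%g.
rewrite !SL2_mxM VA; exact: (icosahedral_pair xx aa ax t2).
Qed.

(** * Binary dihedral groups *)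

Section BDModel.
Variables (F : fieldType) (n : nat) (xi : F).
Hypotheses (n_gt0 : (0 < n)%N) (prim_xi : (2 * n).-primitive_root xi).

Let D (z : F) := mx2 z 0 0 z^-1.
Let J (z : F) := mx2 0 z (- z^-1) 0.

Let DD z w : D z * D w = D (z * w).
Proof. by apply: mx2P; rewrite !mul2 !mxE /= ?invfM; ring. Qed.
Let DJ z w : D z * J w = J (z * w).
Proof. by apply: mx2P; rewrite !mul2 !mxE /= ?invfM; ring. Qed.
Let JD z w : J z * D w = J (z / w).
Proof. by apply: mx2P; rewrite !mul2 !mxE /= ?invfM ?invrK; ring. Qed.
Let JJ z w : J z * J w = D (- (z / w)).
Proof. by apply: mx2P; rewrite !mul2 !mxE /= ?invrN ?invfM ?invrK; ring. Qed.
Let D1 : D 1 = 1.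
Proof. by apply: mx2P; rewrite !mxE /= ?invr1. Qed.

Let mu (z : F) := z ^+ (2 * n) == 1.

Let mu_neq0 z : mu z -> z != 0.
Proof.
apply: contraTneq => ->.
by rewrite /mu expr0n muln_eq0 /= eqn0Ngt n_gt0 eq_sym oner_eq0.
Qed.
Let muM z w : mu z -> mu w -> mu (z * w).
Proof. by move=> /eqP ez /eqP ew; rewrite /mu exprMn ez ew mulr1. Qed.
Let muV z : mu z -> mu z^-1.
Proof. by move=> /eqP ez; rewrite /mu exprVn ez invr1. Qed.
Let muN z : mu z -> mu (- z).
Proof. by rewrite /mu !exprM sqrrN. Qed.

Let E : {fset 'M[F]_2} :=
  ([fset D (xi ^+ (i : 'I_(2 * n))) | i in 'I_(2 * n)] `|`
   [fset J (xi ^+ (i : 'I_(2 * n))) | i in 'I_(2 * n)])%fset.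

(** Every 2n-th root of unity is a power of [xi]; testing by [mu] avoids exponent arithmetic modulo
    2n in the closure proofs. *)
Let EP A : reflect (exists2 z, mu z & A = D z \/ A = J z) (A \in E).
Proof.
have muX i : mu (xi ^+ i) by rewrite /mu exprAC (prim_expr_order prim_xi) expr1n.
apply: (iffP (fsetUP _ _ _)) => [[]/imfsetP[i _ ->]|[z /eqP muz [] ->]].
- by exists (xi ^+ i); [exact: muX | left].
- by exists (xi ^+ i); [exact: muX | right].
- by have [i ->] := prim_rootP prim_xi muz; left; apply/imfsetP; exists i.
- by have [i ->] := prim_rootP prim_xi muz; right; apply/imfsetP; exists i.
Qed.

Let Edet A : A \in E -> \det A = 1.
Proof.
case/EP=> z /mu_neq0 z0 [] ->; rewrite det2 !mxE /=; first by rewrite mul0r subr0 mulfV.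
by rewrite mul0r sub0r mulrN opprK mulfV.
Qed.

Let E1 : 1%:M \in E.
Proof. by apply/EP; exists 1; [rewrite /mu expr1n | left; rewrite D1]. Qed.

Let EM A B : A \in E -> B \in E -> A *m B \in E.
Proof.
case/EP=> z muz [] -> /EP[w muw [] ->]; apply/EP; rewrite mulmxE.
- by exists (z * w); [exact: muM | left].
- by exists (z * w); [exact: muM | right].
- by exists (z / w); [apply: muM => //; exact: muV | right].
- by exists (- (z / w)); [apply: muN; apply: muM => //; exact: muV | left].
Qed.

Let EV A : A \in E -> invmx A \in E.
Proof.
move=> EA; have uA : A \in unitmx by rewrite unitmxE Edet ?unitr1.
suff [B EB AB] : exists2 B, B \in E & A *m B = 1.
  by have -> : invmx A = B by apply: (can_inj (mulKmx uA)); rewrite mulmxV.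
case/EP: EA => z muz [] ->; have z0 := mu_neq0 muz.
  exists (D z^-1); last by rewrite mulmxE DD mulfV.
  by apply/EP; exists z^-1; [exact: muV | left].
exists (J (- z)); last by rewrite mulmxE JJ invrN mulrN opprK mulfV.
by apply/EP; exists (- z); [exact: muN | right].
Qed.

(** Sending sigma to [D xi] and tau to [J 1] gives a quotient of the presented group, which bounds
    the order of that group from below. *)
Lemma BD_model : exists (gT : finGroupType) (H : {group gT}),
  (H \homg Grp (s : t : t ^+ 2 = s ^+ n = (t * s) ^+ 2))%g /\ (4 * n <= #|H|)%N.
Proof.
pose H := SL2FinGroup Edet E1 EM EV.
have muxi : mu xi by rewrite /mu (prim_expr_order prim_xi).
have Es : D xi \in E by apply/EP; exists xi; last by left.
have Et : J 1 \in E by apply/EP; exists 1; [rewrite /mu expr1n | right].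
pose s : H := FSetSub Es; pose t : H := FSetSub Et.
have sX i : SL2_mx (s ^+ i)%g = D (xi ^+ i).
  rewrite SL2_mxX /SL2_mx /=; elim: i => [|i IHi]; first by rewrite !expr0 D1.
  by rewrite !exprS IHi DD.
have os : #[s]%g = (2 * n)%N.
  apply/eqP; rewrite eqn_dvd order_dvdn (prim_order_dvd prim_xi).
  apply/andP; split.
    by apply/eqP/SL2_mx_inj; rewrite sX (prim_expr_order prim_xi) D1.
  apply/eqP; have := congr1 (@SL2_mx F H) (expg_order s).
  rewrite sX => /matrixP/(_ 0 0); by rewrite !mxE.
have xin : xi ^+ n = - 1.
  have /eqP : (xi ^+ n) ^+ 2 = 1 by rewrite -exprM mulnC (prim_expr_order prim_xi).
  rewrite sqrf_eq1 => /orP[|/eqP//]; rewrite -(prim_order_dvd prim_xi).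
  by move/(dvdn_leq n_gt0); rewrite leqNgt ltn_Pmull.
exists H, [set: H]%G; split.
  apply/existsP; exists (s, t); rewrite /= !xpair_eqE; apply/and3P; split.
  - rewrite eqEsubset subsetT /=; apply/subsetP => h _.
    have /EP[z /eqP muz hE] := fsvalP h.
    have [i zi] := prim_rootP prim_xi muz.
    have ss : (s ^+ i)%g \in (<[s]> <*> <[t]>)%g.
      by rewrite groupX // (subsetP (joing_subl _ _)) ?cycle_id.
    case: hE => hE.
      by have -> : h = (s ^+ i)%g by apply: SL2_mx_inj; rewrite sX -zi.
    have -> : h = (s ^+ i * t)%g.
      by apply: SL2_mx_inj; rewrite SL2_mxM sX -zi DJ mulr1.
    by rewrite groupM // (subsetP (joing_subr _ _)) ?cycle_id.
  - apply/eqP/SL2_mx_inj; rewrite !SL2_mxX SL2_mxM /SL2_mx /= !expr2 JD !JJ.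
    by rewrite !divff ?oner_eq0 // div1r invr_eq0 mu_neq0.
  - apply/eqP/SL2_mx_inj; rewrite sX SL2_mxX SL2_mxM /SL2_mx /= expr2 JD !JJ xin.
    by rewrite divff // div1r invr_eq0 mu_neq0.
(* [t] is not diagonal, so it is not a power of [s]; the order of H is a multiple of 2n larger than
   2n. *)
have lt_s : (2 * n < #|[set: H]|)%N.
  rewrite -os; apply: proper_card; rewrite properEneq subsetT andbT.
  apply/eqP => sH; have /cycleP[i ti] : t \in <[s]>%g by rewrite sH inE.
  have := congr1 (@SL2_mx F H) ti; rewrite sX => /matrixP/(_ 0 1).
  by rewrite !mxE => /eqP; rewrite /= oner_eq0.
have := order_dvdG (in_setT s); rewrite os => /dvdnP[m eH].
move: lt_s; rewrite eH -{1}[(2 * n)%N]mul1n ltn_pmul2r ?muln_gt0 // => m2.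
by rewrite -[4%N]/(2 * 2)%N -mulnA leq_mul2r m2 orbT.
Qed.

End BDModel.

(** The relations make t invert s while fixing s^n = t^2, so s^(2n) = 1. They also give |G| <= 2
    #[s], and the model's bound 4n <= |G| then forces the order of s. *)
Lemma BD_generators (F : fieldType) (n : nat) (xi : F) (gT : finGroupType)
    (G : {group gT}) :
  (0 < n)%N -> (2 * n).-primitive_root xi -> is_BD n G ->
  exists s t : gT, [/\ #[s] = (2 * n)%N, t ^+ 2 = s ^+ n & s ^ t = s^-1]%g.
Proof.
move=> n0 prim_xi isoG; have /existsP[[s t] /=] := isoGrp_hom isoG.
rewrite !xpair_eqE => /and3P[/eqP defG /eqP et /eqP es].
have {}et : (t ^+ 2 = s ^+ n)%g by rewrite et es.
have sJ : (s ^ t = s^-1)%g.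
  have : (t * (s * (t * s)) = t * t)%g.
    by have := es; rewrite -et !expg2 -!mulgA => <-.
  move/mulgI => e; have est : (s * t = t * s^-1)%g by rewrite -{2}e mulgA mulgK.
  by rewrite conjgE est mulKg.
exists s, t; split=> //.
have sn2 : (s ^+ (2 * n) = 1)%g.
  have e : ((s ^+ n) ^ t = s ^+ n)%g by rewrite -et conjXg conjgE mulKg.
  by rewrite mulnC expgM expg2 -{1}e conjXg sJ expVgn mulVg.
have [hT [H [homH leH]]] := BD_model n0 prim_xi.
have le4n : (4 * n <= #|G|)%N.
  by apply: leq_trans leH _; apply: leq_homg; rewrite isoG.
have nst : <[t]>%g \subset 'N(<[s]>)%g.
  rewrite cycle_subG; apply/normP; rewrite -genJ conjg_set1 sJ.
  exact: cycleV.
(* |G| times the order of the intersection of <s> and <t> is #[s] #[t]; the intersection contains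
   t^2, whose order is at least half that of t. *)
have leG : (#|G| <= #[s]%g * 2)%N.
  have t2G : <[t ^+ 2]>%g \subset (<[s]> :&: <[t]>)%g.
    by rewrite cycle_subG inE mem_cycle et mem_cycle.
  have t2 : (#[t]%g <= 2 * #[t ^+ 2]%g)%N.
    apply: dvdn_leq; first by rewrite muln_gt0 order_gt0.
    by rewrite order_dvdn expgM expg_order.
  have := mul_cardG <[s]> <[t]>; rewrite -(norm_joinEr nst) defG => eG.
  rewrite -(leq_pmul2r (order_gt0 (t ^+ 2)%g)) -mulnA.
  apply: leq_trans (leq_mul (leqnn _) t2).
  rewrite -[X in (_ <= X)%N]/(#|<[s]>%g| * #|<[t]>%g|)%N eG.
  by rewrite leq_mul2l subset_leq_card ?orbT.
apply/eqP; rewrite eqn_leq dvdn_leq ?muln_gt0 ?order_dvdn ?sn2 //=.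
by rewrite -(leq_pmul2r (isT : 0 < 2)%N) (leq_trans _ leG) // mulnAC.
Qed.

(** (A - 1)^2 = 0, so A^N = 1 + N (A - 1), and N is invertible in characteristic 0. *)
Lemma unipotent_finite_order (F : fieldType) (A : 'M[F]_2) N :
  [pchar F] =i pred0 -> (0 < N)%N -> \det A = 1 -> \tr A = 2 -> A ^+ N = 1 -> A = 1.
Proof.
move=> F0 N0 dA tA AN.
have AX k : A ^+ k = 1 + k%:R *: (A - 1).
  elim: k => [|k IHk]; first by rewrite expr0 scale0r addr0.
  rewrite exprS IHk mulrDr -scalerAr mulrBr sqr_SL2 // tA !mulr1 mulrSr.
  by apply/matrixP => i j; rewrite !mxE; ring.
move: AN => /eqP; rewrite AX -subr_eq0 addrAC subrr add0r scaler_eq0.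
by rewrite ((pcharf0P F).1 F0) -leqn0 leqNgt N0 subr_eq0 => /eqP.
Qed.

(** The prescribed root [xi] need not be an eigenvalue of A. An eigenvalue z of A has order exactly
    N, since z^m = 1 makes A^m unipotent of finite order; so [xi] is a power of z. *)
Lemma trace_power (C : closedFieldType) (A : 'M[C]_2) (N : nat) (xi : C) :
  [pchar C] =i pred0 -> (0 < N)%N -> \det A = 1 -> A ^+ N = 1 ->
  (forall m, A ^+ m = 1 -> (N %| m)%N) -> N.-primitive_root xi ->
  exists k, \tr (A ^+ k) = xi + xi^-1.
Proof.
move=> C0 N0 dA AN ordA prim_xi; pose t := \tr A.
(* [z] is a root of the characteristic polynomial X^2 - tX + 1. *)
have [z ez] := @solve_monicpoly C 2 (fun i => if i == 0%N then - 1 else t) isT.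
have {}ez : z ^+ 2 = t * z - 1.
  by rewrite ez !big_ord_recl big_ord0 /= expr0 expr1 mulr1 addr0 addrC.
have z0 : z != 0.
  by apply/eqP => z0; move/eqP: ez; rewrite z0 expr0n mulr0 sub0r eq_sym oppr_eq0 oner_eq0.
have tz : t = z + z^-1.
  by apply: (mulIf z0); rewrite mulrDl mulVf // -expr2 ez subrK.
have trX k : \tr (A ^+ k) = z ^+ k + (z ^+ k)^-1.
  suff [] : \tr (A ^+ k) = z ^+ k + (z ^+ k)^-1 /\
            \tr (A ^+ k.+1) = z ^+ k.+1 + (z ^+ k.+1)^-1 by [].
  elim: k => [|k [IHk IHk1]]; first by rewrite !expr0 !expr1 mxtrace1 invr1.
  have -> : A ^+ k.+2 = t *: A ^+ k.+1 - A ^+ k.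
    by rewrite (exprS A k.+1) (exprS A k) mulrA sqr_SL2 // mulrBl mul1r -scalerAl.
  split=> //; rewrite mxtraceD mxtraceZ linearN /= IHk IHk1 tz !exprS.
  by field; rewrite z0 expf_neq0.
have dX k : \det (A ^+ k) = 1.
  by elim: k => [|k IHk]; rewrite ?expr0 ?det1 // exprS -mulmxE det_mulmx dA IHk mul1r.
have zN : z ^+ N = 1.
  have := trX N; rewrite AN mxtrace1 => e.
  have zN0 : z ^+ N != 0 by rewrite expf_neq0.
  apply/eqP; rewrite -subr_eq0 -sqrf_eq0; apply/eqP.
  have : (z ^+ N + (z ^+ N)^-1) * z ^+ N = 2 * z ^+ N by rewrite -e.
  rewrite mulrDl mulVf // => {}e.
  have -> : (z ^+ N - 1) ^+ 2 = z ^+ N * z ^+ N + 1 - 2 * z ^+ N by ring.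
  by rewrite e subrr.
have [m prim_z dvm] := prim_order_exists N0 zN.
have mN : m = N.
  apply/eqP; rewrite eqn_dvd dvm; apply: ordA.
  apply: (unipotent_finite_order C0 N0 (dX m)); last by rewrite -exprM mulnC exprM AN expr1n.
  by rewrite trX (prim_expr_order prim_z) invr1.
rewrite mN in prim_z.
have [k ->] := prim_rootP prim_z (prim_expr_order prim_xi).
by exists k.
Qed.

(** The embedding lets the lemma serve over C, with [idfun], and over K, while [xi] stays in C. The
    element t^2 = s^n has order 2, hence is -1. *)
Lemma SL2_BD (F : fieldType) (C : closedFieldType) (iota : {rmorphism F -> C})
    (G : SL2_fingroup F) (n : nat) (xi : C) :
  [pchar C] =i pred0 -> (0 < n)%N -> (2 * n).-primitive_root xi ->
  is_BD n [set: G]%G ->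
  exists s t : G, [/\ iota (\tr (SL2_mx s)) = xi + xi^-1,
    SL2_mx t * SL2_mx t = - 1 & (s * t = t * s^-1)%g].
Proof.
move=> C0 n0 prim_xi isoG.
have n2C : (2 : C) != 0 by rewrite ((pcharf0P C).1 C0).
have n2 : (2 : F) != 0 by rewrite -(fmorph_eq0 iota) rmorph_nat.
have n2n0 : (0 < 2 * n)%N by rewrite muln_gt0.
have [s [t [os et sJ]]] := BD_generators (G := [set: G]%G) n0 prim_xi isoG.
have [k trk] : exists k, \tr (map_mx iota (SL2_mx s) ^+ k) = xi + xi^-1.
  have sX m : map_mx iota (SL2_mx s) ^+ m = map_mx iota (SL2_mx (s ^+ m)%g).
    by rewrite SL2_mxX rmorphXn.
  apply: (trace_power C0 n2n0) => //.
  - by rewrite det_map_mx det_SL2_mx rmorph1.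
  - by rewrite sX -os expg_order map_mx1.
  move=> m; rewrite sX -os order_dvdn => e; apply/eqP/SL2_mx_inj.
  by apply: (map_mx_inj (f := iota)); rewrite e map_mx1.
exists (s ^+ k)%g, t; split.
- by rewrite -trk -rmorphXn -SL2_mxX /mxtrace rmorph_sum; apply: eq_bigr => i _; rewrite mxE.
- rewrite -SL2_mxM; apply: SL2_involution => //.
    by rewrite -[(t * t)%g]/(t ^+ 2)%g et -expgM mulnC -os expg_order.
  rewrite -[(t * t)%g]/(t ^+ 2)%g et => /eqP; rewrite -order_dvdn os.
  by move/(dvdn_leq n0); rewrite leqNgt ltn_Pmull.
- by rewrite -expgVn -sJ -conjXg conjgE mulKVg.
Qed.

(** S - c is (S - S^-1)/2, the traceless part of S; conjugation by T inverts S and so negates it. *)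
Lemma BD_quaternion (F : fieldType) (S T : 'M[F]_2) (c : F) :
  \det S = 1 -> \tr S = 2 * c -> T * T = - 1 -> S * T = T * (\tr S *: 1 - S) ->
  (S - c *: 1) * (S - c *: 1) = (c ^+ 2 - 1)%:M /\
  T * (S - c *: 1) = - ((S - c *: 1) * T).
Proof.
move=> dS tS TT ST; split.
  rewrite mulrBl !mulrBr sqr_SL2 // -!scalerAl -!scalerAr !mulr1 !mul1r tS -scalemx1.
  by apply/matrixP => i j; rewrite !mxE; ring.
rewrite mulrBr mulrBl ST tS mulrBr -!scalerAl -!scalerAr mulr1 mul1r.
by move: (T * S) => X; apply/matrixP => i j; rewrite !mxE; ring.
Qed.

(** * Cyclic, binary dihedral and polyhedral cases combined *)

Theorem theorem4p10 (K : fieldType) (charK0 : [pchar K] =i pred0)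
    (C : closedFieldType) (iota : {rmorphism K -> C})
    (algC : forall x : C, algebraicOver iota x)
    (G : SL2_fingroup C)
    (charG : forall g : G, exists k : K, iota k = natural_char g) :
  [/\ forall n : nat, (0 < n)%N -> ([set: G] \isog Zp n)%g ->
        realisable_over K G,
      forall n : nat, (2 <= n)%N -> is_BD n [set: G]%G ->
        forall xi : C, (2 * n).-primitive_root xi ->
        let c : C := 2^-1 * (xi + xi^-1) in
        exists d : K, [/\ iota d = c ^+ 2 - 1, d != 0 &
          realisable_over K G <-> hilbert_symbol (-1) d = 1]
    & is_BT [set: G]%G \/ is_BO [set: G]%G \/ is_BI [set: G]%G ->
        (realisable_over K G <-> hilbert_symbol (-1) (-1 : K) = 1)].
Proof.
have C0 : [pchar C] =i pred0 by move=> p; rewrite (fmorph_pchar iota).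
have n2 : (2 : K) != 0 by rewrite ((pcharf0P K).1 charK0).
have n2C : (2 : C) != 0 by rewrite ((pcharf0P C).1 C0).
split.
- by move=> n _ isoG; apply: realisable_cyclic charG; rewrite (isog_cyclic isoG) cyclic_Zp.
- move=> n n_gt1 isoG xi prim_xi c; have n0 := ltnW n_gt1.
  have [s [t [trs tt st]]] := SL2_BD idfun C0 n0 prim_xi isoG.
  have [k ke] := charG s; rewrite /= in trs.
  have {}ke : iota k = xi + xi^-1 by rewrite ke.
  pose c0 := k / 2; have c0E : iota c0 = c by rewrite fmorph_div rmorph_nat ke mulrC.
  have trS : \tr (SL2_mx s) = 2 * c by rewrite trs /c mulVKf.
  have ST : SL2_mx s * SL2_mx t = SL2_mx t * (\tr (SL2_mx s) *: 1 - SL2_mx s).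
    by rewrite -SL2_mxM st SL2_mxM SL2_mxV.
  (* c^2 - 1 = ((xi^2 - 1) / (2 xi))^2 vanishes only if xi^2 = 1, which is excluded by 2n > 2. *)
  have d0 : c0 ^+ 2 - 1 != 0.
    apply/eqP => d0; have : c ^+ 2 = 1.
      by apply/eqP; rewrite -subr_eq0 -c0E -rmorphXn -(rmorph1 iota) -rmorphB /= d0 rmorph0.
    have xi0 : xi != 0.
      apply/eqP => xi0; have := prim_expr_order prim_xi.
      by rewrite xi0 expr0n muln_eq0 /= eqn0Ngt n0 => /eqP; rewrite eq_sym oner_eq0.
    move=> c2; have : (xi ^+ 2 - 1) ^+ 2 = 0.
      have -> : (xi ^+ 2 - 1) ^+ 2 = (c ^+ 2 - 1) * (2 * xi) ^+ 2.
        by rewrite /c; field; rewrite xi0 n2C.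
      by rewrite c2 subrr mul0r.
    move/eqP; rewrite sqrf_eq0 subr_eq0 -(prim_order_dvd prim_xi).
    by move/(@dvdn_leq _ 2%N isT); rewrite leqNgt -[X in (X < _)%N]muln1 ltn_pmul2l ?n_gt1.
  exists (c0 ^+ 2 - 1); rewrite rmorphB rmorphXn rmorph1 /= c0E; split=> //.
  split=> [[H isoGH]|/(sum_two_squares n2)[z [x dE]]].
    have isoH : is_BD n [set: H]%G := isoGrp_trans (isog_symr isoGH) isoG.
    have [s' [t' [trs' tt' st']]] := SL2_BD iota C0 n0 prim_xi isoH.
    apply/hilbert1P.
    have trS' : \tr (SL2_mx s') = 2 * c0.
      by apply: (fmorph_inj iota); rewrite trs' rmorphM rmorph_nat c0E /c mulVKf.
    have ST' : SL2_mx s' * SL2_mx t' = SL2_mx t' * (\tr (SL2_mx s') *: 1 - SL2_mx s').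
      by rewrite -SL2_mxM st' SL2_mxM SL2_mxV.
    have [uu tu] := BD_quaternion (det_SL2_mx s') trS' tt' ST'.
    exact: quaternion_isotropic tt' uu tu.
  have [uu tu] := BD_quaternion (det_SL2_mx s) trS tt ST.
  have dC : iota (z ^+ 2 + x ^+ 2) = c ^+ 2 - 1.
    by rewrite -dE rmorphB rmorphXn rmorph1 /= c0E.
  (* tr(g (h - c)) = tr(gh) - c tr(g) is a combination of character values with c in K. *)
  have linear (g h : G) : exists k, iota k = \tr (SL2_mx g * (SL2_mx h - c *: 1)).
    have [k1 e1] := charG (g * h)%g; have [k2 e2] := charG g.
    exists (k1 - c0 * k2); rewrite rmorphB rmorphM /= c0E e1 e2.
    by rewrite mulrBr -scalerAr mulr1 linearB linearZ.
  apply: (@realisable_quaternion _ _ iota _ _ _ z x n2 _ tt _ tu).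
  + by rewrite -dE.
  + by rewrite uu dC.
  move=> g; split; [exact: charG | exact: (charG (g * t)%g) | exact: linear|].
  by rewrite mulrA; apply: (linear (g * t)%g).
have poly k : k \in [:: 3; 4; 5]%N ->
    ([set: G] \isog Grp (a : b : a ^+ 3 = b ^+ k = (a * b) ^+ 2))%g ->
    (realisable_over K G <-> hilbert_symbol (-1) (-1 : K) = 1).
  move=> k345 isoG; split=> [[H isoGH]|/(sum_two_squares n2)[z [x dE]]].
    have isoH := isoGrp_trans (H := [set: G]%G) (G := [set: H]%G) (isog_symr isoGH) isoG.
    have [i [j [ii jj ij]]] := triangle_quaternions k345 isoH.
    apply/hilbert1P; apply: quaternion_isotropic ii _ ij.
    by rewrite jj -scalemx1 scaleN1r.
  have [i [j [ii jj ij]]] := triangle_quaternions k345 isoG.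
  apply: (@realisable_quaternion _ _ iota _ _ _ z x n2 _ ii _ ij).
  - by rewrite -dE oppr_eq0 oner_eq0.
  - by rewrite -dE rmorphN rmorph1 jj -scalemx1 scaleN1r.
  (* Since i and j belong to G, all four traces are values of the character. *)
  move=> g; split; [exact: charG | exact: (charG (g * i)%g) | exact: (charG (g * j)%g)|].
  exact: (charG (g * (i * j))%g).
by case=> [|[]]; apply: poly.
Qed.
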